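(* Let $k,m,s$ be positive integers and let $\mathcal F$ be a family of $k$-multisets of $[m]$ such that no more than $s$ members of $\mathcal F$ are pairwise disjoint. If $m > (2k-1)s$, then \[|\mathcal F| \leq \binom{m+k-1}{k} - \binom{m-s+k-1}{k}.\] Equality holds if and only if $\mathcal F$ is the family of all $k$-multisets of $[m]$ that intersect a given set of size $s$.
   Context: A $k$-multiset of $[m]=\{1,\dots,m\}$ is a multiset of cardinality $k$ (counting repetitions) with elements from $[m]$; $\mathrm{m}(i,A)$ denotes the multiplicity of $i$ in $A$. The intersection of multisets $A,B$ is the multiset $C$ with $\mathrm{m}(i,C)=\min\{\mathrm{m}(i,A),\mathrm{m}(i,B)\}$ (a set is regarded as a multiset with all multiplicities one); two multisets are disjoint if their intersection is empty, and they intersect otherwise. *)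

(* Defs.v *)
From mathcomp Require Import all_boot.
From mathcomp Require Import finmap multiset.

Set Implicit Arguments.
Unset Strict Implicit.
Unset Printing Implicit Defensive.

Local Open Scope nat_scope.
Local Open Scope mset_scope.

(* [m] = {1, ..., m} is represented by 'I_m.  The size of the underlying
   sequence of a multiset counts repetitions. *)
Definition kmultiset (k m : nat) (A : {mset 'I_m}) : Prop := size A = k.

(* [mdisjoint A B] says that the multiset intersection, whose multiplicities
   are the minima of those of A and B, is empty. *)
Definition intersecting (m : nat) (A B : {mset 'I_m}) : bool :=
  ~~ mdisjoint A B.

Definition mset_of_set (m : nat) (S : {set 'I_m}) : {mset 'I_m} :=
  seq_mset (enum S).

Definition pairwise_disjoint (m : nat) (G : {fset {mset 'I_m}}) : Prop :=
  forall A B : {mset 'I_m}, A \in G -> B \in G -> A != B -> mdisjoint A B.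

Definition at_most_pairwise_disjoint
    (s m : nat) (F : {fset {mset 'I_m}}) : Prop :=
  forall G : {fset {mset 'I_m}},
    (G `<=` F)%fset -> pairwise_disjoint G -> #|` G| <= s.

Lemma mset_of_setE (m : nat) (S : {set 'I_m}) (i : 'I_m) :
  mset_of_set S i = (i \in S).
Proof. by rewrite mset_seqE count_uniq_mem ?enum_uniq // mem_enum. Qed.

(* Main.v *)
(** Frankl's bound for the Erdos matching problem, transported to multisets.

    A sorted multiset b_0 <= ... <= b_(k-1) of [m] is encoded by the k-subset of [m + k - 1] made of
    its support and of the points m + j for the repetitions b_j = b_(j+1).  This is a bijection, and
    the trace of the code on [m] is the support.  Hence the family of all k-subsets of [m + k - 1]
    containing the support of some member of F has no s + 1 pairwise disjoint members and is at least
    as large as F; in the case of equality it is the star of an s-set, which has to lie in [m].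

    For k-sets on n >= (2s+1)(k-1) + s + 1 points, the family may be taken to be shifted; a star
    obtained by a shift comes from a star.  Split a shifted family by the trace on the first s + 1
    points.  The members with trace {i} give nested cross-dependent families F_0, ..., F_s, for which
    averaging over the images of 2s+1 disjoint sets yields
    |F_0| + ... + |F_(s-1)| + (s+1) |F_s| <= s C(n-s-1, k-1).  The shadow of the family H of members
    with empty trace lies in F_s, and |H| < s |F_s| unless H is empty; this strictness gives
    uniqueness. *)

Require Import Defs.
From mathcomp Require Import all_boot all_fingroup.
From mathcomp Require Import zify.
From mathcomp Require Import finmap multiset.

Set Implicit Arguments.
Unset Strict Implicit.
Unset Printing Implicit Defensive.

Local Open Scope nat_scope.
Local Open Scope mset_scope.

(** * Disjoint selections and averaging over permutations *)

Lemma subset_of_card (T : finType) (U : {set T}) l :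
  l <= #|U| -> exists2 B : {set T}, B \subset U & #|B| = l.
Proof.
rewrite -bin_gt0 -cards_draws card_gt0 => /set0Pn[B].
by rewrite inE => /andP[sBU /eqP cB]; exists B.
Qed.

Lemma card_ord_lt n s : s <= n -> #|[set x : 'I_n | x < s]| = s.
Proof.
move=> sn; have inj : injective (widen_ord sn) by move=> x y /(congr1 val)/= /val_inj.
rewrite -[RHS]card_ord -(card_imset _ inj); apply: eq_card => x; rewrite inE.
apply/idP/imsetP=> [xs|[y _ ->]]; last exact: (ltn_ord y).
by exists (Ordinal xs); last exact: val_inj.
Qed.

Lemma disjoint_selection (I T : finType) (Q : {set I}) (U : {set T}) l :
  #|Q| * l <= #|U| ->
  exists f : I -> {set T},
    (forall x, x \in Q -> f x \subset U /\ #|f x| = l) /\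
    {in Q &, forall x y, x != y -> [disjoint f x & f y]}.
Proof.
have [k] := ubnP #|Q|; elim: k Q U => // k IH Q U ltk.
have [->|/set0Pn[a aQ]] := eqVneq Q set0.
  by move=> _; exists (fun=> set0); split=> [x|x y]; rewrite inE.
rewrite (cardsD1 a) aQ mulnDl mul1n => leU.
have [B sBU cB] : exists2 B : {set T}, B \subset U & #|B| = l.
  by apply: subset_of_card; lia.
have [||f [fU fD]] := IH (Q :\ a) (U :\: B).
- by move: ltk; rewrite (cardsD1 a) aQ.
- by rewrite (cardsD U) (setIidPr sBU); lia.
have fB x : x \in Q -> x != a -> [disjoint B & f x].
  move=> xQ xa; have [|sf _] := fU x; first by rewrite !inE xa.
  rewrite -setI_eq0; apply/eqP/setP=> z; rewrite !inE.
  apply/negP=> /andP[zB /(subsetP sf)]; by rewrite inE zB.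
exists (fun x => if x == a then B else f x); split=> [x xQ|x y xQ yQ xy].
  case: eqP => [//|/eqP xa]; have [|sf cf] := fU x; first by rewrite !inE xa.
  by split=> //; apply: subset_trans sf (subsetDl _ _).
have [xa|xa] := eqVneq x a; have [ya|ya] := eqVneq y a.
- by rewrite xa ya eqxx in xy.
- exact: fB.
- by rewrite disjoint_sym; apply: fB.
- by apply: fD => //; rewrite !inE ?xa ?ya.
Qed.

(** Representatives are chosen for s, s - 1, ..., 0 in turn: at index i only s - i points are taken,
    and [J i] has more. *)
Lemma greedy_representatives (T : finType) s (J : nat -> {set T}) :
  (forall i, i <= s -> s - i < #|J i|) ->
  exists e : nat -> T, (forall i, i <= s -> e i \in J i) /\
    (forall i j, i < j <= s -> e i != e j).
Proof.
elim: s J => [|s IH] J hJ.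
  have := hJ 0 (leqnn _); rewrite card_gt0 => /set0Pn[x xJ].
  by exists (fun=> x); split=> [i|i j]; [rewrite leqn0 => /eqP-> | lia].
have [i les|e [eJ eD]] := IH (fun i => J i.+1); first exact: hJ.
pose E := [set e (val i) | i : 'I_s.+1].
have [x] : exists x, x \in J 0 :\: E.
  apply/set0Pn; rewrite -card_gt0 cardsD subn_gt0.
  apply: leq_ltn_trans (hJ 0 isT); rewrite subn0.
  apply: leq_trans (subset_leq_card (subsetIr _ _)) _.
  by apply: leq_trans (leq_imset_card _ _) _; rewrite card_ord.
rewrite inE => /andP[xE xJ].
exists (fun i => if i is i'.+1 then e i' else x); split=> [[|i]//|[|i] [|j] // le].
- exact: eJ.
- apply: contra xE => /eqP->; apply/imsetP.
  by exists (Ordinal (ltn_ord (inord j : 'I_s.+1))); rewrite //= inordK //; lia.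
- by apply: eD; lia.
Qed.

Section Averaging.

Variables (T : finType) (W : {set T}).

Let G := [set p : {perm T} | perm_on W p].

(** A transposition exchanging a point of [C :\: D] with a point of [D :\: C] brings C closer to D
    inside W. *)
Lemma perm_on_transitive (C D : {set T}) :
  C \subset W -> D \subset W -> #|C| = #|D| ->
  exists2 q : {perm T}, perm_on W q & q @: C = D.
Proof.
have [k] := ubnP #|C :\: D|; elim: k C => // k IH C.
have [sCD _ _ _ cCD|] := boolP (C \subset D).
  exists 1%g; first exact: perm_on1.
  have /eqP <- : C == D by rewrite eqEcard sCD cCD /=.
  by apply/setP=> x; rewrite (eq_imset (g := id)) ?imset_id // => y; rewrite perm1.
case/subsetPn=> x xC xD ltk CW DW cCD.
have [y yD yC] : exists2 y, y \in D & y \notin C.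
  apply/subsetPn; apply: contra xD => sDC.
  have /eqP -> // : D == C by rewrite eqEcard sDC cCD /=.
have xW := subsetP CW x xC; have yW := subsetP DW y yD.
have tW : perm_on W (tperm x y).
  by apply: subset_trans (tperm_on x y) _; rewrite subUset !sub1set xW yW.
have tC : tperm x y @: C = y |: (C :\ x).
  apply/setP=> z; rewrite -{1}(tpermK x y z) mem_imset; last exact: perm_inj.
  rewrite !inE; case: tpermP => [->|->|/eqP nx /eqP ny].
  - by rewrite (negPf yC) eqxx orbF; apply/esym/negP=> /eqP xy; rewrite -xy xC in yC.
  - by rewrite eqxx.
  - by rewrite nx (negPf ny).
have [||||q qW qC] := IH (tperm x y @: C).
- rewrite tC; apply: leq_trans (_ : #|C :\: D| <= k); last by [].
  apply: proper_card; apply/properP; split.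
    apply/subsetP=> z; rewrite !inE => /andP[zD /orP[/eqP zy|/andP[_ ->]]].
      by rewrite zy yD in zD.
    by rewrite zD.
  exists x; first by rewrite inE xC xD.
  by rewrite !inE eqxx xD /= orbF; apply: contraNneq yC => <-.
- rewrite tC subUset sub1set yW /=; exact: subset_trans (subsetDl _ _) CW.
- by [].
- by rewrite card_imset ?cCD //; exact: perm_inj.
exists (tperm x y * q)%g; first exact: perm_onM.
rewrite -qC -imset_comp; apply: eq_imset => z; by rewrite permM.
Qed.

(** Group the permutations by the image of B. Right multiplication by a q carrying D to C maps the
    fibre of D onto that of C, so all ['C(#|W|, #|B|)] fibres have the same size. *)
Lemma card_perm_on_image (B C : {set T}) :
  B \subset W -> C \subset W -> #|C| = #|B| ->
  #|[set p in G | p @: B == C]| * 'C(#|W|, #|B|) = #|G|.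
Proof.
move=> BW CW cCB.
pose L := [set D : {set T} | D \subset W & #|D| == #|B|].
have NE D : D \in L -> #|[set p in G | p @: B == D]| = #|[set p in G | p @: B == C]|.
  rewrite inE => /andP[DW /eqP cD].
  have [|q qW qC] := perm_on_transitive DW CW; first by rewrite cD.
  have inj : injective (fun p : {perm T} => p * q)%g by exact: mulIg.
  rewrite -(card_imset _ inj); apply: eq_card => p.
  apply/imsetP/idP=> [[r]|].
    rewrite !inE => /andP[rW /eqP rB] ->; rewrite perm_onM //=.
    rewrite -qC -rB -imset_comp; apply/eqP/eq_imset=> z; by rewrite permM.
  rewrite !inE => /andP[pW /eqP pB]; exists (p * q^-1)%g; last by rewrite mulgKV.
  rewrite !inE perm_onM ?perm_onV //=.
  have <- : q^-1%g @: C = D.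
    rewrite -qC -imset_comp -[RHS]imset_id; apply: eq_imset=> z /=; exact: permK.
  rewrite -pB -imset_comp; apply/eqP/eq_imset=> z; by rewrite permM.
rewrite -cards_draws -/L mulnC -sum_nat_const.
rewrite -(eq_bigr _ NE) -[RHS]sum1_card.
rewrite (partition_big (fun p : {perm T} => p @: B) (mem L)) /=.
  by apply: eq_bigr=> D _; rewrite -sum1_card; apply: eq_bigl=> p; rewrite !inE.
move=> p; rewrite !inE => pW.
rewrite card_imset ?eqxx ?andbT; last exact: perm_inj.
apply/subsetP=> _ /imsetP[z zB ->]; by rewrite (perm_closed _ pW) (subsetP BW).
Qed.

(** Double counting: for each j and each C in F, a fraction one over ['C(#|W|, l)] of the
    permutations carries [B j] to C. *)
Lemma sum_hits (l : nat) (J : finType) (B : J -> {set T}) (F : {set {set T}}) :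
  (forall j, B j \subset W /\ #|B j| = l) ->
  (forall C, C \in F -> C \subset W /\ #|C| = l) ->
  (\sum_(p in G) #|[set j | p @: B j \in F]|) * 'C(#|W|, l) = #|J| * #|F| * #|G|.
Proof.
move=> hB hF.
have -> : \sum_(p in G) #|[set j | p @: B j \in F]| =
   \sum_j \sum_(C in F) #|[set p in G | p @: B j == C]|.
  under eq_bigr => p _ do rewrite -sum1_card big_mkcond /=.
  rewrite exchange_big /=; apply: eq_bigr => j _.
  under [RHS]eq_bigr => C _ do rewrite -sum1_card big_mkcond /=.
  rewrite [RHS]exchange_big /= [LHS]big_mkcond /=; apply: eq_bigr => p _.
  rewrite inE; case: (boolP (p \in G)) => pG; last first.
    by rewrite big1 // => C _; rewrite inE (negPf pG).
  case: (boolP (_ \in F)) => pF.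
    rewrite (bigD1 (p @: B j)) //= inE pG eqxx /= big1 // => C /andP[_ /negPf ne].
    by rewrite inE eq_sym ne andbF.
  rewrite big1 // => C CF; rewrite inE; case: eqP => [e|]; last by rewrite andbF.
  by rewrite e CF in pF.
have -> : #|J| * #|F| * #|G| = \sum_(j : J) \sum_(C in F) #|G|.
  by rewrite -mulnA !sum_nat_const.
rewrite big_distrl /=; apply: eq_bigr => j _.
rewrite big_distrl /=; apply: eq_bigr => C CF.
have [sB cB] := hB j; have [sC cC] := hF C CF.
by rewrite -{1}cB card_perm_on_image // cC cB.
Qed.

(* Averages the trivial inequality for a random disjoint system of 2s+1 sets. *)
Lemma cross_dependent_bound s l (F : nat -> {set {set T}}) :
  (2 * s + 1) * l <= #|W| ->
  (forall i C, i <= s -> C \in F i -> C \subset W /\ #|C| = l) ->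
  (forall i j, i <= j <= s -> F j \subset F i) ->
  (forall B : nat -> {set T}, (forall i, i <= s -> B i \in F i) ->
     ~ (forall i j, i < j <= s -> [disjoint B i & B j])) ->
  \sum_(i < s) #|F i| + s.+1 * #|F s| <= s * 'C(#|W|, l).
Proof.
move=> hW hF hN hD.
have [|B [hB dB]] := @disjoint_selection 'I_(2 * s + 1) T setT W l.
  by rewrite cardsT card_ord.
pose b i (p : {perm T}) := #|[set j | p @: B j \in F i]|.
have hb p i : b i p <= 2 * s + 1.
  by rewrite -[X in _ <= X]card_ord; apply: max_card.
(* If every [b i p] exceeded s - i, distinct representatives would give disjoint members of F 0,
   ..., F s. So some i has [b i p <= s - i], and nesting extends this bound to every j from i to
   s. *)
have local p : \sum_(i < s) b i p + s.+1 * b s p <= s * (2 * s + 1).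
  have [i lis bi] : exists2 i, i <= s & b i p <= s - i.
    case: (boolP [exists i : 'I_s.+1, b i p <= s - i]) => [/existsP[i bi]|/existsPn/= big].
      by exists i; rewrite // -ltnS.
    have [i lis|e [eJ eD]] := @greedy_representatives _ s (fun i => [set j | p @: B j \in F i]).
      by have := big (inord i); rewrite -ltnNge inordK.
    case: (hD (fun i => p @: B (e i))) => [i lis|i j lij]; first by have := eJ i lis; rewrite inE.
    rewrite -setI_eq0 -imsetI; last by move=> x y _ _; apply: perm_inj.
    have /eqP -> : B (e i) :&: B (e j) == set0 by rewrite setI_eq0 dB ?inE ?eD.
    by rewrite imset0.
  have mono j : i <= j <= s -> b j p <= s - i.
    move=> ij; apply: leq_trans bi; apply: subset_leq_card; apply/subsetP=> x.
    by rewrite !inE; apply/subsetP/hN.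
  have sumb : \sum_(j < s) b j p <= i * (2 * s + 1) + (s - i) * (s - i).
    rewrite -(big_mkord predT (fun j => b j p)) (big_cat_nat (n := i)) //=.
    apply: leq_add.
      rewrite -[X in X * _](subn0 i) -sum_nat_const_nat; exact: leq_sum.
    rewrite -sum_nat_const_nat !big_nat; apply: leq_sum => j jb.
    by apply: mono; lia.
  (* With d = s - i the left side is at most i (2s + 1) + d (d + s + 1), and d + s + 1 <= 2s + 1:
     hence the choice of 2s + 1 sets. *)
  have bs := mono s ltac:(lia).
  have [d sd] : exists d, s = i + d by exists (s - i); lia.
  have ed : s - i = d by lia.
  rewrite ed in sumb bs; nia.
have bin0 : 0 < 'C(#|W|, l) by rewrite bin_gt0; nia.
have Gpos : 0 < #|G|.
  by rewrite card_gt0; apply/set0Pn; exists 1%g; rewrite inE perm_on1.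
have hit i : i <= s ->
    (\sum_(p in G) b i p) * 'C(#|W|, l) = (2 * s + 1) * #|F i| * #|G|.
  by move=> lis; rewrite (sum_hits (fun j => hB j (in_setT j)) (fun C => hF i C lis)) card_ord.
have tot : (\sum_(p in G) (\sum_(i < s) b i p + s.+1 * b s p)) * 'C(#|W|, l)
   = (2 * s + 1) * (\sum_(i < s) #|F i| + s.+1 * #|F s|) * #|G|.
  rewrite big_split /= mulnDl -big_distrr /= -mulnA hit // exchange_big /=.
  rewrite big_distrl /= (eq_bigr (fun i : 'I_s => (2 * s + 1) * #|G| * #|F i|)).
    by rewrite -big_distrr /=; lia.
  by move=> i _; rewrite hit ?(ltnW (ltn_ord i)) //; lia.
have : \sum_(p in G) (\sum_(i < s) b i p + s.+1 * b s p) <= #|G| * (s * (2 * s + 1)).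
  by rewrite -sum_nat_const; apply: leq_sum.
rewrite -(leq_pmul2r bin0) tot => le.
rewrite -(@leq_pmul2l ((2 * s + 1) * #|G|)); last by rewrite muln_gt0 Gpos addn1.
by move: le; set X := _ + _; set C := binomial _ _; lia.
Qed.

End Averaging.

(** * Shadows of shifted families *)

Lemma disjoint_setU1_family (T : finType) (Q : {set T}) (h : T -> {set T}) :
  (forall x, x \in Q -> [disjoint h x & Q]) ->
  {in Q &, forall x y, x != y -> [disjoint h x & h y]} ->
  {in Q &, forall x y, x != y -> [disjoint x |: h x & y |: h y]}.
Proof.
move=> hQ hD x y xQ yQ xy.
rewrite -setI_eq0 setIUl !setIUr !setU_eq0 !setI_eq0 hD //.
rewrite disjoints1 inE xy disjoints1 disjoint_sym disjoints1 /= andbT.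
by rewrite (disjointFl (hQ y yQ)) ?(disjointFl (hQ x xQ)).
Qed.

(* Members are indexed by the points of Q, so that repeated empty members count as disjoint. *)
Definition no_disjoint_family (T : finType) s (F : {set {set T}}) : Prop :=
  forall (Q : {set T}) (f : T -> {set T}), #|Q| = s.+1 ->
    (forall x, x \in Q -> f x \in F) ->
    ~ {in Q &, forall x y, x != y -> [disjoint f x & f y]}.

Definition shadow (T : finType) (H : {set {set T}}) : {set {set T}} :=
  [set B : {set T} | [exists (x : T | x \notin B), x |: B \in H]].

Lemma shadowP (T : finType) (H : {set {set T}}) (B : {set T}) :
  reflect (exists2 x : T, x \notin B & x |: B \in H) (B \in shadow H).
Proof. by rewrite inE; apply: exists_inP. Qed.

Section Ordered.

Variable n : nat.
Implicit Types (W A B : {set 'I_n}) (H F : {set {set 'I_n}}).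

Definition shifted_in W H := forall A (x y : 'I_n),
  A \in H -> x \in A -> y \in W -> y < x -> y \notin A -> y |: (A :\ x) \in H.

Definition uniform_in k W H := forall A, A \in H -> A \subset W /\ #|A| = k.

Lemma no_disjoint_family_sub (T : finType) s (F F' : {set {set T}}) :
  F' \subset F -> no_disjoint_family s F -> no_disjoint_family s F'.
Proof. by move=> /subsetP sF nF Q f cQ fF; apply: nF => // x /fF; apply: sF. Qed.

Lemma setU1D1C (T : finType) (x y z : T) (A : {set T}) : x != y ->
  x |: (A :\ y) = (x |: A) :\ y.
Proof. by move=> xy; rewrite setDUl; congr (_ :|: _); apply/esym/setDidPl; rewrite disjoints1 inE. Qed.

Lemma shifted_shadow W H : shifted_in W H -> shifted_in W (shadow H).
Proof.
move=> sH B w y /shadowP[x xB xH] wB yW yw yB.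
have nyw : y != w by rewrite neq_ltn yw.
have nxw : x != w by apply: contraNneq xB => ->.
(* If x is y, the removed point w completes the shifted set; otherwise x does, by a shift of
   [x |: B]. *)
apply/shadowP; have [exy|xy] := eqVneq x y.
  exists w; first by rewrite !inE eqxx /= orbF eq_sym.
  by rewrite setUCA setD1K // -exy.
exists x; first by rewrite !inE (negPf xy) (negPf xB) andbF.
have -> : x |: (y |: B :\ w) = y |: ((x |: B) :\ w).
  by apply/setP=> z; rewrite !inE; case: (z =P w) => [->|_];
     rewrite ?(eq_sym w x) ?(negPf nxw) //= orbCA.
by apply: sH; rewrite ?inE ?wB ?orbT // negb_or eq_sym xy.
Qed.

Lemma uniform_shadow k W H : uniform_in k.+1 W H -> uniform_in k W (shadow H).
Proof.
move=> uH B /shadowP[x xB /uH[+ cB]]; rewrite subUset => /andP[_ sB]; split=> //.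
by move: cB; rewrite cardsU1 xB => -[].
Qed.

(** Pairs (x, A) with x in A are grouped by [A :\ x]; each set of the shadow arises from at most |W|
    - k points x. *)
Lemma shadow_double_count k W H : uniform_in k.+1 W H ->
  k.+1 * #|H| <= #|shadow H| * (#|W| - k).
Proof.
move=> uH.
pose P := [set z : 'I_n * {set 'I_n} | (z.1 \in z.2) && (z.2 \in H)].
have cP : #|P| = k.+1 * #|H|.
  rewrite mulnC -sum_nat_const -sum1_card (partition_big snd (mem H)) /=; last first.
    by move=> z; rewrite inE => /andP[].
  apply: eq_bigr => A AH; have [_ <-] := uH A AH.
  have inj : injective (fun x : 'I_n => (x, A)) by move=> x y [].
  rewrite sum1_card -(card_imset (mem A) inj); apply: eq_card => -[x B].
  rewrite unfold_in inE; apply/andP/imsetP => [[/andP[xA _] /eqP/= e]|[y yA [-> ->]]].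
    by exists x; rewrite -?e.
  by rewrite yA AH eqxx.
rewrite -cP -sum_nat_const -sum1_card.
rewrite (partition_big (fun z => z.2 :\ z.1) (mem (shadow H))) /=; last first.
  move=> [x A]; rewrite inE /= => /andP[xA AH]; apply/shadowP.
  by exists x; rewrite ?setD1K // !inE eqxx.
apply: leq_sum => B /(uniform_shadow uH)[sBW cB].
rewrite sum1_card; have <- : #|W :\: B| = #|W| - k by rewrite cardsD (setIidPr sBW) cB.
have inj : {in [set z | (z \in P) && (z.2 :\ z.1 == B)] &, injective (fst : 'I_n * {set 'I_n} -> 'I_n)}.
  move=> [x A] [y C]; rewrite !inE /= => /andP[/andP[xA _] /eqP eA] /andP[/andP[yC _] /eqP eC] exy.
  by rewrite -(setD1K xA) -(setD1K yC) eA eC exy.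
rewrite -cardsE -(card_in_imset inj); apply: subset_leq_card; apply/subsetP=> _ /imsetP[[x A] + ->].
rewrite !inE /= => /andP[/andP[xA AH] /eqP <-]; rewrite !inE eqxx /=.
by have [/subsetP -> //] := uH A AH.
Qed.

(* Frankl's inequality |H| <= s |shadow H|, in a strict form that makes the extremal configuration of
   the matching theorem unique. *)
Lemma shadow_lower_bound s k W H : 0 < s < n ->
  uniform_in k.+1 W H -> shifted_in W H -> no_disjoint_family s (shadow H) ->
  H != set0 -> #|H| < s * #|shadow H|.
Proof.
case/andP=> s0 sn; have [t] := ubnP #|W|; elim: t k W H => // t IH k W H ltt uH sH nH H0.
(* Singletons have the empty set in their shadow, and s + 1 copies of it count as disjoint; s < n
   provides the s + 1 indices. *)
have k1 : 0 < k.
  case: k uH => // uH; have /set0Pn[A AH] := H0; have [_ /eqP/cards1P[x Ax]] := uH A AH.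
  have [|Q _ cQ] := @subset_of_card _ [set: 'I_n] s.+1; first by rewrite cardsT card_ord.
  case: (nH Q (fun=> set0) cQ) => [y _|y z _ _ _]; last by rewrite -setI_eq0 set0I.
  by apply/shadowP; exists x; rewrite ?inE ?setU0 -?Ax.
have dH0 : 0 < #|shadow H|.
  have /set0Pn[A AH] := H0; have [_ cA] := uH A AH.
  have /set0Pn[x xA] : A != set0 by rewrite -card_gt0 cA.
  rewrite card_gt0; apply/set0Pn; exists (A :\ x); apply/shadowP; exists x.
    by rewrite !inE eqxx.
  by rewrite setD1K.
(* On a small ground set double counting suffices. Otherwise the largest point w of W is removed,
   and H splits into the members avoiding w and those through w, with w deleted. *)
have [small|large] := ltnP (#|W| - k) (k.+1 * s).
  have dc := shadow_double_count uH.
  rewrite -(@ltn_pmul2l k.+1) //; apply: leq_ltn_trans dc _.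
  by rewrite mulnCA mulnC mulnA ltn_pmul2r // mulnC.
have W0 : 0 < #|W| by nia.
have /card_gt0P[w0 w0W] := W0.
have [w wW wmax] : exists2 w : 'I_n, w \in W & forall y : 'I_n, y \in W -> y <= w.
  by case: (arg_maxnP (fun y : 'I_n => y : nat) w0W) => w wW wm; exists w.
pose W' := W :\ w.
pose H0' := [set A in H | w \notin A].
pose H1 := [set B : {set 'I_n} | (w \notin B) && (w |: B \in H)].
have cW' : #|W| = #|W'|.+1 by rewrite (cardsD1 w) wW.
have cH : #|H| = #|H0'| + #|H1|.
  have inj : {in H1 &, injective (fun B => w |: B)}.
    move=> B C; rewrite !inE => /andP[wB _] /andP[wC _] e.
    by rewrite -(setU1K wB) -(setU1K wC) e.
  rewrite -(card_in_imset inj) -(cardsID [set A : {set 'I_n} | w \in A] H) addnC.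
  congr (_ + _); apply: eq_card => A; first by rewrite !inE andbC.
  rewrite !inE; apply/andP/imsetP => [[AH wA]|[B]].
    by exists (A :\ w); rewrite ?setD1K // inE !inE eqxx setD1K.
  by rewrite inE => /andP[wB BH] ->; rewrite !inE eqxx.
have H1P B : B \in shadow H1 ->
    w \notin B /\ exists x, [/\ x \notin B, w != x & w |: (x |: B) \in H].
  case/shadowP=> x xB; rewrite inE in_setU1 negb_or => /andP[/andP[wx wB] BH].
  by split=> //; exists x.
(* Sets in the shadow of [H0'] avoid w; adding w to those in the shadow of [H1] gives sets through
   w. *)
have cS : #|shadow H0'| + #|shadow H1| <= #|shadow H|.
  have inj : {in shadow H1 &, injective (fun B => w |: B)}.
    by move=> B C /H1P[wB _] /H1P[wC _] e; rewrite -(setU1K wB) -(setU1K wC) e.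
  rewrite -(card_in_imset inj) -cardsUI.
  have -> : shadow H0' :&: [set w |: B | B in shadow H1] = set0.
    apply/setP=> A; rewrite in_set0; apply/negP; rewrite in_setI => /andP[/shadowP[x xA]].
    by rewrite !inE negb_or => /andP[_ /andP[_ wA]] /imsetP[B _ e]; rewrite e !inE eqxx in wA.
  rewrite cards0 addn0; apply: subset_leq_card; rewrite subUset; apply/andP; split.
    apply/subsetP=> A /shadowP[x xA]; rewrite inE => /andP[xH _].
    by apply/shadowP; exists x.
  apply/subsetP=> _ /imsetP[B /H1P[wB [x [xB wx BH]]] ->]; apply/shadowP; exists x.
    by rewrite !inE negb_or eq_sym wx.
  by rewrite setUCA.
have ltW' : #|W'| < t by rewrite -ltnS -cW'.
have b0 : H0' != set0 -> #|H0'| < s * #|shadow H0'|.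
  apply: (IH k W') => //.
  - move=> A; rewrite inE => /andP[/uH[sA cA] wA]; split=> //.
    by rewrite subsetD1 sA.
  - move=> A x y; rewrite !inE => /andP[AH wA] xA /andP[yw yW] yx yA.
    by rewrite sH //= (negPf wA) andbF orbF eq_sym.
  - apply: no_disjoint_family_sub nH; apply/subsetP=> A /shadowP[x xA]; rewrite inE => /andP[xH _].
    by apply/shadowP; exists x.
(* Disjoint (k-1)-sets [f x] cover at most (s+1)(k-1) points, leaving s + 1 fresh points below w.
   Shifting w to a different fresh point in each [w |: f x] gives disjoint members of the shadow of
   H. *)
have nH1 : no_disjoint_family s (shadow H1).
  move=> Q f cQ fH fD.
  have fs x : x \in Q -> f x \subset W' /\ #|f x| = k.-1.
    move=> /fH/H1P[wf [y [yf wy]]] /uH[].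
    rewrite !subUset cardsU1 in_setU1 negb_or wy wf cardsU1 yf => /and3P[_ _ sf] [<-].
    by rewrite subsetD1 sf wf.
  pose U := \bigcup_(x in Q) f x.
  have cU : #|U| <= s.+1 * k.-1.
    rewrite -cQ -sum_nat_const /U; elim/big_rec2: _ => [|x b A xQ le]; rewrite ?cards0 //.
    by have [_ <-] := fs x xQ; have [+ _] := leq_card_setU (f x) A; lia.
  have [|p [pU pD]] := @disjoint_selection _ _ Q (W' :\: U) 1.
    rewrite muln1 cQ cardsD; have := subset_leq_card (subsetIr W' U); nia.
  apply: (nH Q (fun x => p x :|: f x) cQ) => [x xQ|x y xQ yQ xy].
    have [spx /eqP/cards1P[y py]] := pU x xQ; rewrite py in spx *.
    rewrite sub1set !inE in spx; have /andP[yU /andP[yw yW]] := spx.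
    have /H1P[wf [z [zf wz wzf]]] := fH x xQ.
    have yf : y \notin f x by apply: contra yU => yf; apply/bigcupP; exists x.
    have := shifted_shadow sH (A := w |: f x) (x := w) (y := y).
    rewrite setU1K //; apply; rewrite ?inE ?eqxx //.
    - by apply/exists_inP; exists z; rewrite ?inE ?negb_or ?(eq_sym z) ?wz // setUCA.
    - by rewrite ltn_neqAle wmax // andbT.
    - by rewrite negb_or yw.
  have [sx _] := pU x xQ; have [sy _] := pU y yQ.
  have out z : z \in Q -> forall v, v \in Q -> [disjoint f z & p v].
    move=> zQ v vQ; rewrite -setI_eq0; apply/eqP/setP=> i; rewrite !inE.
    apply/negP=> /andP[iz iv]; have [/subsetP/(_ i iv)] := pU v vQ.
    by rewrite !inE => /andP[/negP[]]; apply/bigcupP; exists z.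
  rewrite -setI_eq0 setIUl !setIUr !setU_eq0 !setI_eq0 pD // fD // out //.
  by rewrite disjoint_sym out.
have b1 : H1 != set0 -> #|H1| < s * #|shadow H1|.
  move=> H1n0; apply: (IH k.-1 W') => //; rewrite ?prednK //.
  - move=> A; rewrite inE => /andP[wA /uH[]]; rewrite subUset cardsU1 wA => /andP[_ sA] [cA].
    by split=> //; rewrite subsetD1 sA.
  - move=> A x y; rewrite !inE => /andP[wA AH] xA /andP[yw yW] yx yA.
    rewrite negb_or eq_sym yw /= (negPf wA) andbF /=.
    have xw : x != w by apply: contraNneq wA => <-.
    have -> : w |: (y |: A :\ x) = y |: ((w |: A) :\ x).
      by rewrite setUCA (@setU1D1C _ w x) // eq_sym.
    by apply: sH; rewrite ?inE ?xA ?orbT // negb_or yw.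
have [e0|n0] := eqVneq H0' set0; have [e1|n1] := eqVneq H1 set0.
- by move: H0; rewrite -card_gt0 cH e0 e1 !cards0.
- by have := b1 n1; rewrite cH e0 cards0; nia.
- by have := b0 n0; rewrite cH e1 cards0; nia.
- by have := b1 n1; have := b0 n0; rewrite cH; nia.
Qed.
End Ordered.

(** * Shifted families *)

Definition star (T : finType) k (S : {set T}) : {set {set T}} :=
  [set A : {set T} | (#|A| == k) && ~~ [disjoint A & S]].

Lemma card_star (T : finType) k (S : {set T}) :
  #|star k S| = 'C(#|T|, k) - 'C(#|T| - #|S|, k).
Proof.
have -> : #|T| - #|S| = #|~: S| by rewrite [RHS]cardsCs setCK.
rewrite -card_draws -cards_draws -cardsDS.
  apply: eq_card => A; rewrite !inE disjoints_subset.
  by case: (#|A| == k); rewrite ?andbF ?andbT.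
by apply/subsetP=> A; rewrite !inE => /andP[].
Qed.

Lemma sum_nat_bool (T : finType) (F : {set T}) (P : pred T) :
  \sum_(A in F) (P A : nat) = #|[set A in F | P A]|.
Proof.
rewrite -sum1_card big_mkcond [RHS]big_mkcond; apply: eq_bigr => A _.
by rewrite inE; case: (A \in F) => //=; case: (P A).
Qed.

Section Initial.

Variables (n s : nat).
Hypothesis sn : s < n.+1.
Local Notation T := 'I_n.+1.
Implicit Types (F : {set {set T}}) (A B : {set T}).

Let V := [set x : T | x <= s].
Let W := ~: V.

(** Indexed by naturals to fit [cross_dependent_bound]; [inord i] is the point i whenever i <= s. *)
Definition link F (i : nat) : {set {set T}} :=
  [set B : {set T} | (B \subset W) && (inord i |: B \in F)].

Lemma inord_ini i : i <= s -> (inord i : T) \in V.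
Proof. by move=> lis; rewrite inE inordK //; lia. Qed.

Lemma inord_out i B : i <= s -> B \subset W -> inord i \notin B.
Proof. by move=> lis /subsetP sB; apply: contraL (inord_ini lis) => /sB; rewrite inE. Qed.

Lemma inord_neq i j : i < j <= s -> (inord i : T) != inord j.
Proof. by move=> ij; rewrite -(inj_eq val_inj) /= !inordK; lia. Qed.

Lemma inord_add_capV i B : i <= s -> B \subset W -> (inord i |: B) :&: V = [set inord i].
Proof.
move=> lis sB; rewrite setIUl (setIidPl _); last by rewrite sub1set inord_ini.
by apply/setUidPl; have -> : B :&: V = set0 by [apply/eqP; rewrite setI_eq0 disjoints_subset]; rewrite sub0set.
Qed.

Lemma card_link F i : i <= s -> #|link F i| = #|[set A in F | A :&: V == [set inord i]]|.
Proof.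
move=> lis; have inj : {in link F i &, injective (fun B => inord i |: B)}.
  move=> B C; rewrite !inE => /andP[/(inord_out lis) iB _] /andP[/(inord_out lis) iC _] e.
  by rewrite -(setU1K iB) -(setU1K iC) e.
rewrite -(card_in_imset inj); apply: eq_card => A; apply/imsetP/idP => [[B]|].
  by rewrite !inE => /andP[sB BF] ->; rewrite BF inord_add_capV ?eqxx.
rewrite inE => /andP[AF /eqP AV].
have iA : inord i \in A by have := set11 (inord i : T); rewrite -AV inE => /andP[].
exists (A :\ inord i); last by rewrite setD1K.
by rewrite inE setD1K // AF andbT /W -AV setDIr setDv set0U -disjoints_subset -setI_eq0 setIC setIDA setIC setDIl setDv setI0.
Qed.

Lemma link_decomposition F : #|F| = #|[set A in F | A \subset W]| + \sum_(i < s.+1) #|link F i|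
   + #|[set A in F | 1 < #|A :&: V|]|.
Proof.
rewrite (eq_bigr (fun i : 'I_s.+1 => \sum_(A in F) (A :&: V == [set inord i] : nat))); last first.
  by move=> i _; rewrite sum_nat_bool card_link // -ltnS.
rewrite exchange_big /= -!sum_nat_bool -!big_split /= -sum1_card; apply: eq_bigr => A AF.
have -> : (A \subset W) = (#|A :&: V| == 0) by rewrite cards_eq0 setI_eq0 disjoints_subset.
case: (boolP (#|A :&: V| == 1)) => [/cards1P[x eA]|n1].
  rewrite eA cards1 /= addn0.
  have : x \in A :&: V by rewrite eA set11.
  rewrite !inE => /andP[_ xs]; rewrite (bigD1 (inord x)) //= inordK // inord_val eqxx big1 // => j.
  rewrite -(inj_eq val_inj) /= inordK // => /negPf jx.
  rewrite eqEsubset sub1set inE -(inj_eq val_inj) /= inordK ?(eq_sym (val x)) ?jx //.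
  by have := ltn_ord j; lia.
rewrite big1 ?addn0; first by case: #|_| n1 => [|[|]].
by move=> i _; case: eqP => // e; rewrite e cards1 in n1.
Qed.

Lemma cardV : #|V| = s.+1.
Proof.
exact: card_ord_lt sn.
Qed.

Lemma cardW : #|W| = n - s.
Proof. by rewrite cardsCs setCK card_ord cardV subSS. Qed.

(** F and the star E are compared along [link_decomposition]. E has every larger trace and full
    links below s. The averaged bound counts [link F s] with weight s + 1: one unit pays for that
    link, the other s pay for the members with empty trace. *)
Lemma shifted_star_bound k F : 0 < s -> (2 * s + 1) * k + s < n.+1 ->
  uniform_in k.+1 setT F -> shifted_in setT F -> no_disjoint_family s F ->
  #|F| <= #|star k.+1 [set x : T | x < s]| /\
  (#|F| = #|star k.+1 [set x : T | x < s]| -> F = star k.+1 [set x : T | x < s]).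
Proof.
move=> s0 hn uF sF nF; set S := [set x | _]; set E := star _ _.
pose H F := [set A in F | A \subset W].
have sh i A (x : T) : i <= s -> A \in F -> x \in A -> i < x -> inord i \notin A ->
    inord i |: (A :\ x) \in F.
  by move=> lis AF xA ix; apply: sF => //; rewrite ?inE // inordK //; lia.
have uL i C : i <= s -> C \in link F i -> C \subset W /\ #|C| = k.
  move=> lis; rewrite inE => /andP[sC /uF[_ cC]]; split=> //.
  by move: cC; rewrite cardsU1 (inord_out lis) // => -[].
have nest i j : i <= j <= s -> link F j \subset link F i.
  case: (eqVneq i j) => [-> //|nij] /andP[lij ljs]; apply/subsetP=> B; rewrite !inE => /andP[sB BF].
  have lis : i <= s by lia.
  have ij : i < j by rewrite ltn_neqAle nij.
  rewrite sB -(setU1K (inord_out ljs sB)); apply: sh; rewrite // ?inE ?eqxx //.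
    by rewrite inordK //; lia.
  by rewrite negb_or (inord_out lis) // andbT inord_neq ?ij.
have cross (B : nat -> {set T}) : (forall i, i <= s -> B i \in link F i) ->
     ~ (forall i j, i < j <= s -> [disjoint B i & B j]).
  move=> BL BD; apply: (nF V (fun x => x |: B x)); first exact: cardV.
    by move=> x; rewrite inE => /BL; rewrite inE inord_val => /andP[].
  have sBW (x : T) : x \in V -> B x \subset W by rewrite inE => /BL; rewrite inE => /andP[].
  apply: disjoint_setU1_family => [x /sBW|x y]; first by rewrite disjoints_subset.
  rewrite !inE => xs ys; rewrite neq_ltn => /orP[xy|yx]; first by rewrite BD // xy.
  by rewrite disjoint_sym BD // yx.
have uH : uniform_in k.+1 W (H F).
  by move=> A; rewrite inE => /andP[/uF[_ ->]].
have sHW : shifted_in W (H F).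
  move=> A x y; rewrite !inE => /andP[AF sA] xA yV yx yA.
  rewrite sF ?inE //= subUset sub1set inE inE yV.
  exact: subset_trans (subsetDl _ _) sA.
(* The point completing B lies beyond s, so a shift moves it to s. *)
have shL : shadow (H F) \subset link F s.
  apply/subsetP=> B /shadowP[x xB]; rewrite !inE subUset sub1set => /andP[BF /andP[+ sB]].
  rewrite !inE -ltnNge => sx; rewrite sB -(setU1K xB); apply: sh; rewrite ?setU11 //.
  rewrite in_setU1 negb_or (inord_out _ sB) // andbT -(inj_eq val_inj) /= inordK //; lia.
(* By nesting, s + 1 disjoint members of the last link, in the order of [enum Q], also serve as one
   member of each link. *)
have nL : no_disjoint_family s (link F s).
  move=> Q f cQ fL fD; pose e i := nth ord0 (enum Q) i.
  have eQ i : i <= s -> e i \in Q by move=> lis; rewrite -mem_enum mem_nth // -cardE cQ.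
  apply: (cross (fun i => f (e i))) => [i lis|i j ij].
    by apply: (subsetP (nest i s _)); rewrite ?lis ?leqnn //; apply/fL/eQ.
  apply: fD; try by apply: eQ; lia.
  by rewrite nth_uniq ?enum_uniq // -?cardE ?cQ; lia.
have ave : \sum_(i < s) #|link F i| + s.+1 * #|link F s| <= s * 'C(#|W|, k).
  by apply: cross_dependent_bound => //; rewrite cardW; lia.
have sb : H F != set0 -> #|H F| < s * #|link F s|.
  move=> H0; apply: leq_trans (_ : _ <= s * #|shadow (H F)|) _.
    by apply: (shadow_lower_bound (k := k) (W := W)) => //; [lia | apply: no_disjoint_family_sub nL].
  by rewrite leq_mul2l subset_leq_card ?orbT.
have sS : S \subset V by apply/subsetP=> x; rewrite !inE; lia.
(* The only point of V outside S is s, so two points of V cannot both miss S. *)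
have meets A : 1 < #|A :&: V| -> ~~ [disjoint A & S].
  apply: contraTN; rewrite -setI_eq0 -leqNgt => /eqP AS.
  rewrite -(cards1 (inord s : T)); apply: subset_leq_card; apply/subsetP=> x.
  rewrite !inE => /andP[xA xs]; rewrite -(inj_eq val_inj) /= inordK // eqn_leq xs leqNgt.
  by apply/negP=> xs'; have := in_set0 x; rewrite -AS !inE xA xs'.
have two : #|[set A in F | 1 < #|A :&: V|]| <= #|[set A in E | 1 < #|A :&: V|]|.
  apply: subset_leq_card; apply/subsetP=> A; rewrite !inE => /andP[/uF[_ ->] A2].
  by rewrite eqxx A2 meets.
have linkE : \sum_(i < s) #|link E i| = s * 'C(#|W|, k).
  rewrite -[X in X * _]card_ord -sum_nat_const; apply: eq_bigr => i _.
  rewrite -cards_draws; apply: eq_card => B; rewrite !inE.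
  case sB: (B \subset W) => //=; have lis : i <= s by have := ltn_ord i; lia.
  rewrite cardsU1 (inord_out lis sB) eqSS; case: eqP => // _ /=.
  apply/negP=> /disjointFr/(_ (setU11 _ _)); rewrite inE inordK ?ltn_ord //; lia.
have dF := link_decomposition F; have dE := link_decomposition E.
rewrite big_ord_recr /= in dF; rewrite big_ord_recr /= linkE in dE.
rewrite -/(H F) in dF; rewrite mulSn in ave.
(* For F, the letters h, S0, L, x count the empty traces, the links below s, the link at s and the
   larger traces; primes refer to E, and c is the sum of its links below s. *)
have arith (f h S0 L x e h' c l' x' : nat) : f = h + (S0 + L) + x ->
    e = h' + (c + l') + x' -> S0 + (L + s * L) <= c -> x <= x' -> h <= s * L ->
    f <= e /\ (f = e -> h = s * L).
  by move=> -> -> *; split; lia.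
have le0 : #|H F| <= s * #|link F s|.
  by have [->|/sb/ltnW //] := eqVneq (H F) set0; rewrite cards0.
have [le eqHL] := arith _ _ _ _ _ _ _ _ _ _ dF dE ave two le0.
split=> // eqFE.
(* Equality forces |H F| = s |link F s|, which the strict shadow bound allows only when both are
   empty. *)
have Hs : H F = set0.
  by apply/eqP/negPn/negP=> /sb; rewrite (eqHL eqFE) ltnn.
have Ls : link F s = set0.
  apply/eqP; rewrite -cards_eq0; have /esym/eqP := eqHL eqFE.
  by rewrite Hs cards0 muln_eq0 eqn0Ngt s0.
apply/eqP; rewrite eqEcard eqFE leqnn andbT; apply/subsetP=> A AF.
have [_ cA] := uF A AF; rewrite inE cA eqxx /=.
have [/meets //|] := ltnP 1 #|A :&: V|.
rewrite leq_eqVlt ltnS leqn0 => /orP[|].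
  case/cards1P=> x xA; have : x \in A :&: V by rewrite xA set11.
  rewrite !inE => /andP[x_A]; rewrite leq_eqVlt => /orP[/eqP xs|xs]; last first.
    by apply/negP=> /disjointFr/(_ x_A); rewrite inE xs.
  have ex : x = inord s by rewrite -xs inord_val.
  have : 0 < #|link F s|.
    by rewrite card_link // card_gt0; apply/set0Pn; exists A; rewrite inE AF xA ex eqxx.
  by rewrite Ls cards0.
rewrite cards_eq0 setI_eq0 disjoints_subset => AW.
by have := in_set0 A; rewrite -Hs inE AF AW.
Qed.

End Initial.

(** * Shifting and its reversal *)

Section Shift.

Variables (T : finType) (i j : T).
Implicit Types (F : {set {set T}}) (A B S : {set T}).

Definition swap A := tperm i j @^-1: A.

Lemma in_swap A x : (x \in swap A) = (tperm i j x \in A).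
Proof. by rewrite inE. Qed.

Lemma swapK : involutive swap.
Proof. by move=> A; apply/setP=> x; rewrite !inE tpermK. Qed.

Lemma card_swap A : #|swap A| = #|A|.
Proof. by rewrite card_preimset //; apply: perm_inj. Qed.

Lemma disjoint_swap A B : [disjoint swap A & swap B] = [disjoint A & B].
Proof.
rewrite -!setI_eq0 -preimsetI -!cards_eq0 card_preimset //; exact: perm_inj.
Qed.

Lemma swap_fixed A : (i \in A) = (j \in A) -> swap A = A.
Proof. by move=> e; apply/setP=> x; rewrite inE; case: tpermP => [->|->|]. Qed.

Lemma swap_replace A : i != j -> j \in A -> i \notin A -> swap A = i |: (A :\ j).
Proof.
move=> nij jA iA; apply/setP=> x; rewrite !inE; case: tpermP => [->|->|/eqP xi /eqP xj].
- by rewrite eqxx.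
- by rewrite eqxx eq_sym !(negPf nij) (negPf iA).
- by rewrite (negPf xi) xj.
Qed.

(** The Erdos-Ko-Rado compression from j to i; the last test keeps a set from landing on a present
    member. *)
Definition shift_set F A := if [&& j \in A, i \notin A & swap A \notin F] then swap A else A.

Definition shift F := [set shift_set F A | A in F].

(** A moved set ends outside F and an unmoved one inside, so they cannot collide. *)
Lemma shift_set_inj F : {in F &, injective (shift_set F)}.
Proof.
move=> A B AF BF; rewrite /shift_set.
case: and3P => [[_ _ sA]|_]; case: and3P => [[_ _ sB]|_] //.
- exact: (inv_inj swapK).
- by move=> e; rewrite e BF in sA.
- by move=> e; rewrite -e AF in sB.
Qed.

Lemma card_shift F : #|shift F| = #|F|.
Proof. exact: card_in_imset (@shift_set_inj F). Qed.

Lemma shift_stable F B : B \in shift F -> i \notin B -> B \in F /\ swap B \in F.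
Proof.
case/imsetP=> A AF ->; rewrite /shift_set; case: and3P => [[jA iA _]|nA] iB.
  by rewrite in_swap tpermL jA in iB.
split=> //; apply/negPn/negP=> sA; case: nA; split=> //.
apply: contraNT sA => jA; rewrite swap_fixed //.
by rewrite (negPf iB) (negPf jA).
Qed.

Lemma shift_cases F B : B \in shift F -> B \in F \/ i \in B /\ swap B \in F.
Proof.
case/imsetP=> A AF ->; rewrite /shift_set; case: and3P => [[jA iA _]|nA]; last by left.
by right; rewrite in_swap tpermL swapK.
Qed.

(** Among disjoint sets at most one contains i, and only that one can be new. If it is, swapping i
    and j in all of them returns to F, since the others avoid i and [shift_stable] applies. *)
Lemma no_disjoint_family_shift s F : no_disjoint_family s F -> no_disjoint_family s (shift F).
Proof.
move=> nF Q f cQ fF fD.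
have [/forall_inP allF|] := boolP [forall (x | x \in Q), f x \in F].
  exact: (nF Q f).
rewrite negb_forall_in => /exists_inP[a aQ faF].
have [fa|[ia sa]] := shift_cases (fF a aQ); first by rewrite fa in faF.
apply: (nF Q (fun x => swap (f x)) cQ) => [x xQ|x y xQ yQ xy].
  have [-> //|xa] := eqVneq x a.
  by have [] := shift_stable (fF x xQ) (negbT (disjointFl (fD x a xQ aQ xa) ia)).
by rewrite disjoint_swap; apply: fD.
Qed.

Lemma shift_set_cases F A : shift_set F A = A \/ shift_set F A = swap A.
Proof. by rewrite /shift_set; case: ifP => _; [right|left]. Qed.

Lemma card_shift_set F A : #|shift_set F A| = #|A|.
Proof. by have [->|->] := shift_set_cases F A; rewrite ?card_swap. Qed.

End Shift.

Section Unshift.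

Variables (T : finType) (k s : nat).
Implicit Types (F : {set {set T}}) (A B S : {set T}).
Hypothesis large : (2 * s + 1) * k + s < #|T|.

(** A k-set B outside Q = [i |: (j |: S0)] has colour i or j according to which of [i |: B],
    [j |: B] is in F. Disjoint sets cannot have different colours, and any two k-sets outside Q are
    disjoint from a common third, so a single colour i spreads to all. *)
Lemma star_of_coloring F (i j : T) S0 : i != j -> i \notin S0 -> j \notin S0 -> #|S0|.+1 = s ->
  (forall A, A \in F -> #|A| = k.+1) -> no_disjoint_family s F ->
  (forall A, A \in F -> ~~ [disjoint A & i |: (j |: S0)]) ->
  (forall A, #|A| = k.+1 -> i \notin A -> j \notin A -> ~~ [disjoint A & S0] -> A \in F) ->
  (forall B, #|B| = k -> [disjoint B & i |: (j |: S0)] -> (i |: B \in F) || (j |: B \in F)) ->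
  #|F| = #|star k.+1 (i |: S0)| ->
  (exists B, [/\ #|B| = k, [disjoint B & i |: (j |: S0)] & i |: B \in F]) ->
  F = star k.+1 (i |: S0).
Proof.
move=> nij iS jS cS uF nF meetF fullF color cF [B0 [cB0 dB0 B0F]].
set Q := i |: (j |: S0) in meetF color dB0.
have iQ : i \in Q by rewrite !inE eqxx.
have jQ : j \in Q by rewrite !inE eqxx orbT.
have cQ : #|Q| = s.+1 by rewrite !cardsU1 in_setU1 negb_or nij iS jS -cS.
have cU : #|~: Q| = #|T| - s.+1 by rewrite cardsCs setCK cQ.
(* Otherwise [i |: B], [j |: B'] and the sets [x |: g x], with x in S0 and fresh disjoint [g x], are
   s + 1 disjoint members of F. *)
have clash B B' : #|B| = k -> #|B'| = k -> [disjoint B & Q] -> [disjoint B' & Q] ->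
    [disjoint B & B'] -> i |: B \in F -> j |: B' \notin F.
  move=> cB cB' dB dB' dBB iB; apply/negP=> jB.
  have [|g [gU gD]] := @disjoint_selection _ _ S0 (~: Q :\: (B :|: B')) k.
    have := subset_leq_card (subsetIr (~: Q) (B :|: B')).
    rewrite cardsD cU cardsU; nia.
  have gS x : x \in S0 -> [/\ [disjoint g x & Q], [disjoint g x & B], [disjoint g x & B'] & #|g x| = k].
    move=> xS; have [+ cg] := gU x xS; rewrite setDE subsetI -!disjoints_subset => /andP[dQ dBB'].
    by split=> //; apply: disjointWr dBB'; rewrite ?subsetUl ?subsetUr.
  pose h x := if x == i then B else if x == j then B' else g x.
  have hS x : x \in S0 -> h x = g x.
    move=> xS; rewrite /h; case: eqP => [e|_]; first by rewrite -e xS in iS.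
    by case: eqP => // e; rewrite -e xS in jS.
  have hi : h i = B by rewrite /h eqxx.
  have hj : h j = B' by rewrite /h eq_sym (negPf nij) eqxx.
  have Qcase (P : T -> Prop) : P i -> P j -> (forall x, x \in S0 -> P x) -> forall x, x \in Q -> P x.
    by move=> Pi Pj PS x; rewrite !inE => /or3P[/eqP->|/eqP->|/PS].
  apply: (nF Q (fun x => x |: h x) cQ).
    apply: (Qcase); rewrite ?hi ?hj // => x xS; have [gQ _ _ cg] := gS x xS.
    rewrite hS //; apply: fullF.
    - by rewrite cardsU1 cg (disjointFl gQ) // !inE xS !orbT.
    - by rewrite in_setU1 (disjointFl gQ iQ) orbF; apply: contraNneq iS => ->.
    - by rewrite in_setU1 (disjointFl gQ jQ) orbF; apply: contraNneq jS => ->.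
    - by apply/negP=> /disjointFr/(_ (setU11 _ _)); rewrite xS.
  apply: disjoint_setU1_family.
    by apply: (Qcase); rewrite ?hi ?hj // => x xS; rewrite hS //; have [] := gS x xS.
  move=> x y xQ; move: x xQ y; apply: (Qcase) => [y|y|x xS y] yQ; move: y yQ; apply: (Qcase); rewrite ?hi ?hj ?eqxx //.
  - by move=> y /[dup] yS /hS -> _; rewrite disjoint_sym; have [] := gS y yS.
  - by rewrite disjoint_sym.
  - by move=> y /[dup] yS /hS -> _; rewrite disjoint_sym; have [] := gS y yS.
  - by rewrite hS //; have [] := gS x xS.
  - by rewrite hS //; have [] := gS x xS.
  - by move=> y yS xy; rewrite !hS //; apply: gD.
(* C avoids B and B0: colour i passes from B0 to C, and then excludes colour j for B. *)
have allB B : #|B| = k -> [disjoint B & Q] -> j |: B \notin F.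
  move=> cB dB.
  have [|C sC cC] := @subset_of_card _ (~: Q :\: (B :|: B0)) k.
    have := subset_leq_card (subsetIr (~: Q) (B :|: B0)).
    rewrite cardsD cU cardsU; nia.
  move: sC; rewrite setDE subsetI -!disjoints_subset => /andP[dC dCB].
  have dBC : [disjoint B & C] by rewrite disjoint_sym; apply: disjointWr dCB; apply: subsetUl.
  have dB0C : [disjoint B0 & C] by rewrite disjoint_sym; apply: disjointWr dCB; apply: subsetUr.
  have := color C cC dC; rewrite (negPf (clash B0 C _ _ _ _ _ _)) // orbF => iC.
  by apply: (clash C B); rewrite // disjoint_sym.
(* A member missing [i |: S0] still meets Q, so it contains j and is excluded by [allB]. *)
apply/eqP; rewrite eqEcard cF leqnn andbT; apply/subsetP=> A AF.
rewrite inE uF // eqxx /=; apply: contraL (AF) => dA.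
have jA : j \in A.
  apply: contraNT (meetF A AF) => jA; rewrite /Q setUCA -setI_eq0 setIUr setU_eq0 !setI_eq0.
  by rewrite dA andbT disjoint_sym disjoints1.
have iA : i \notin A by rewrite (disjointFl dA) ?setU11.
rewrite -(setD1K jA); apply: allB.
  by have := uF A AF; rewrite (cardsD1 j) jA => -[].
rewrite /Q setUCA -setI_eq0 setIUr setU_eq0 !setI_eq0.
by rewrite (disjointWl (subsetDl _ _) dA) andbT disjoint_sym disjoints1 !inE eqxx.
Qed.

(** If S contains both or neither of i and j, swapping preserves its star, and F is that star.
    Otherwise the shift only hides, for each B outside Q, whether i or j was added, and
    [star_of_coloring] settles this. *)
Lemma star_unshift F (i j : T) S : i != j -> #|S| = s ->
  (forall A, A \in F -> #|A| = k.+1) -> no_disjoint_family s F ->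
  shift i j F = star k.+1 S -> exists2 S' : {set T}, #|S'| = s & F = star k.+1 S'.
Proof.
move=> nij cS uF nF eF.
have cF : #|F| = #|star k.+1 S| by rewrite -eF card_shift.
have inS A : A \in F -> ~~ [disjoint A & S] || ~~ [disjoint swap i j A & S].
  move=> AF; have : shift_set i j F A \in star k.+1 S by rewrite -eF imset_f.
  by rewrite inE => /andP[_]; have [->|->] := shift_set_cases i j F A => ->; rewrite ?orbT.
have [same|diff] := eqVneq (i \in S) (j \in S).
  exists S => //; apply/eqP; rewrite eqEcard cF leqnn andbT; apply/subsetP=> A AF.
  rewrite inE uF // eqxx /=; have := inS A AF.
  by rewrite -{2}(swap_fixed same) disjoint_swap orbb.
pose S0 := S :\ i :\ j.
have iS0 : i \notin S0 by rewrite !inE eqxx andbF.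
have jS0 : j \notin S0 by rewrite !inE eqxx.
have eS : S = i |: S0 \/ S = j |: S0.
  case: (boolP (i \in S)) diff => [iS jS|iS dj]; [left|right].
    have jS' : j \notin S :\ i by rewrite !inE; case: (j \in S) jS; rewrite ?andbF.
    rewrite /S0; have -> : S :\ i :\ j = S :\ i by apply/setDidPl; rewrite disjoint_sym disjoints1.
    by rewrite setD1K.
  have -> : S0 = S :\ j.
    by rewrite /S0; congr (_ :\ _); apply/setDidPl; rewrite disjoint_sym disjoints1.
  by case: (boolP (j \in S)) dj => [jS _|_ //]; rewrite setD1K.
have cS0 : #|S0|.+1 = s by case: eS => e; rewrite -cS e cardsU1 ?iS0 ?jS0.
set Q := i |: (j |: S0).
have SQ : S \subset Q by case: eS => ->; rewrite /Q ?subsetU1 // setUS // subsetU1.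
have sQ : swap i j Q = Q by rewrite swap_fixed // !inE !eqxx !orbT.
have meetF A : A \in F -> ~~ [disjoint A & Q].
  move=> AF; apply: contraL (AF) => dA; apply/negP=> /inS; rewrite (disjointWr SQ dA) /=.
  by rewrite (disjointWr SQ) // -sQ disjoint_swap.
have S0S : S0 \subset S by rewrite /S0 setDDl subsetDl.
have fullF A : #|A| = k.+1 -> i \notin A -> j \notin A -> ~~ [disjoint A & S0] -> A \in F.
  move=> cA iA _ mA; apply: (proj1 (shift_stable (j := j) _ iA)).
  by rewrite eF inE cA eqxx; apply: contra mA; apply: disjointWr.
have color B : #|B| = k -> [disjoint B & Q] -> (i |: B \in F) || (j |: B \in F).
  move=> cB dB.
  have iB : i \notin B by rewrite (disjointFl dB) // !inE eqxx.
  have jB : j \notin B by rewrite (disjointFl dB) // !inE eqxx orbT.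
  have inF x : x \in S -> x \notin B -> x |: B \in shift i j F.
    move=> xS xB; rewrite eF inE cardsU1 xB cB eqxx /=.
    by apply/negP=> /disjointFr/(_ (setU11 _ _)); rewrite xS.
  have sw : swap i j (i |: B) = j |: B.
    rewrite -[RHS](@swapK _ i j); congr swap; rewrite swap_replace ?setU11 ?setU1K //.
    by rewrite in_setU1 negb_or nij.
  case: eS => eS.
    have /shift_cases[->//|[_]] : i |: B \in shift i j F by rewrite inF // eS setU11.
    by rewrite sw orbC => ->.
  have /shift_cases[->|[]] : j |: B \in shift i j F by rewrite inF // eS setU11.
    by rewrite orbT.
  by rewrite in_setU1 (negPf nij) (negPf iB).
have cStar x : x \notin S0 -> #|x |: S0| = s by move=> xS; rewrite cardsU1 xS.
have cFs x : x \notin S0 -> #|F| = #|star k.+1 (x |: S0)|.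
  by move=> xS; rewrite cF !card_star cS cStar.
have [|B sB cB] := @subset_of_card _ (~: Q) k.
  have cQ : #|Q| = s.+1 by rewrite !cardsU1 in_setU1 negb_or nij iS0 jS0 -cS0.
  rewrite cardsCs setCK cQ; nia.
have dB : [disjoint B & Q] by rewrite disjoints_subset.
(* The colour of one B decides which point joins S0; the second case exchanges i and j. *)
have /orP[iB|jB] := color B cB dB; [exists (i |: S0)|exists (j |: S0)]; rewrite ?cStar //.
  by apply: (star_of_coloring nij iS0 jS0 cS0 uF nF meetF fullF color (cFs i iS0)); exists B.
have eQ : j |: (i |: S0) = Q by rewrite setUCA.
rewrite eq_sym in nij.
apply: (star_of_coloring nij jS0 iS0 cS0 uF nF); rewrite ?eQ ?cFs //.
- by move=> A cA jA iA; apply: fullF.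
- by move=> C cC dC; rewrite orbC color.
- by rewrite -cFs // cFs.
- by exists B.
Qed.

End Unshift.

(** * Frankl's matching bound for arbitrary uniform families *)

Section Frankl.

Variable n : nat.
Implicit Types (F : {set {set 'I_n}}) (A : {set 'I_n}).

Let weight A := \sum_(x in A) (x : nat).

(** The weight is the potential that makes shifting terminate; the equality case gives a strict drop
    whenever a set moves. *)
Lemma weight_shift_set F (i j : 'I_n) A : i < j ->
  weight (shift_set i j F A) <= weight A ?= iff (shift_set i j F A == A).
Proof.
move=> ij; rewrite /shift_set; case: and3P => [[jA iA _]|_]; last by rewrite eqxx; split; rewrite ?eqxx.
have nij : i != j by rewrite neq_ltn ij.
have iA' : i \notin A :\ j by rewrite !inE (negPf iA) andbF.
have lt : weight (swap i j A) < weight A.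
  rewrite /weight swap_replace // big_setU1 //= [X in _ < X](big_setD1 j) //=.
  by rewrite ltn_add2r.
have -> : (swap i j A == A) = false by apply/eqP=> e; rewrite e ltnn in lt.
by split; [exact: ltnW | rewrite ltn_eqF].
Qed.

(** Induction on the total weight: a shift that changes F lowers it and keeps the hypotheses and the
    cardinality, while [star_unshift] carries the equality case back. Shifted families fall under
    [shifted_star_bound]. *)
Theorem frankl_matching_bound k s F : 0 < s -> (2 * s + 1) * k + s < n ->
  (forall A, A \in F -> #|A| = k.+1) -> no_disjoint_family s F ->
  #|F| <= 'C(n, k.+1) - 'C(n - s, k.+1) /\
  (#|F| = 'C(n, k.+1) - 'C(n - s, k.+1) ->
     exists2 S : {set 'I_n}, #|S| = s & F = star k.+1 S).
Proof.
move=> s0 hn.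
have [t] := ubnP (\sum_(A in F) weight A); elim: t F => // t IH F ltt uF nF.
have [sF|] := boolP [forall A in F, [forall x in A, [forall y : 'I_n,
    (y < x) ==> (y \notin A) ==> (y |: (A :\ x) \in F)]]].
  have sh : shifted_in setT F.
    move=> A x y AF xA _ yx yA; move: sF => /forall_inP/(_ A AF)/forall_inP/(_ x xA)/forallP/(_ y).
    by rewrite yx yA.
  have uT : uniform_in k.+1 setT F by move=> A /uF ->; rewrite subsetT.
  case: n hn F uF nF sh uT {IH ltt sF} => [|n'] hn F uF nF sh uT; first by rewrite ltn0 in hn.
  have sn : s < n'.+1 by apply: leq_ltn_trans hn; rewrite leq_addl.
  have [le eq] := shifted_star_bound sn s0 hn uT sh nF.
  have cS : #|[set x : 'I_n'.+1 | x < s]| = s.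
    exact: card_ord_lt (ltnW sn).
  rewrite card_star cS card_ord in le eq; split=> // /eq ->.
  by exists [set x : 'I_n'.+1 | x < s].
rewrite negb_forall_in => /exists_inP[A AF]; rewrite negb_forall_in => /exists_inP[j jA].
rewrite negb_forall => /existsP[i]; rewrite !negb_imply => /and3P[ij iA nAF].
have nij : i != j by rewrite neq_ltn ij.
have [|||le eq] := IH (shift i j F).
- rewrite -ltnS; apply: leq_trans ltt; rewrite ltnS big_imset /=; last exact: shift_set_inj.
  rewrite (bigD1 A) //= [X in _ < X](bigD1 A) //= -addSn; apply: leq_add.
    rewrite ltn_neqAle !weight_shift_set // andbT /shift_set jA iA swap_replace // nAF /=.
    by apply/eqP=> e; rewrite e AF in nAF.
  by apply: leq_sum => B _; rewrite weight_shift_set.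
- by move=> B /imsetP[C CF ->]; rewrite card_shift_set uF.
- exact: no_disjoint_family_shift.
rewrite card_shift in le eq; split=> // /eq[S cS eS].
by apply: star_unshift nij cS uF nF eS; rewrite card_ord.
Qed.

End Frankl.

(** * From multisets to sets *)

(** The default 0 is harmless: only positions with j.+1 < size b are consulted. *)
Definition repeated (b : seq nat) j := nth 0 b j == nth 0 b j.+1.

Lemma sorted_head_mem x y (b : seq nat) : sorted leq [:: x, y & b] ->
  (x \in y :: b) = (x == y).
Proof.
move=> /= /andP[xy pb]; rewrite inE; case: eqP => //= nxy.
apply/negP=> xb; have := allP (order_path_min leq_trans pb) x xb; lia.
Qed.

(** Equal entries of a sorted list form blocks; each block counts once as a value and once per
    further entry as a repetition. *)
Lemma size_undup_repeat (b : seq nat) : sorted leq b ->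
  size (undup b) + \sum_(j < (size b).-1) repeated b j = size b.
Proof.
elim: b => [|x [|y b] IH] sb; rewrite ?big_ord0 //.
have -> : size (undup [:: x, y & b]) = (x != y) + size (undup (y :: b)).
  by rewrite /= -/(undup (y :: b)) (sorted_head_mem sb); case: eqP.
transitivity (size (y :: b)).+1 => //; rewrite -(IH (path_sorted sb)) big_ord_recl.
rewrite (eq_bigr (fun j : 'I_(size b) => repeated (y :: b) j : nat)) //.
by rewrite {1}/repeated /=; case: eqP => _ /=; lia.
Qed.

(** The heads agree, being minima. [repeated] at 0 tells whether the head recurs, which fixes the
    support of the tail for the induction. *)
Lemma eq_sorted_repeat (b c : seq nat) : sorted leq b -> sorted leq c -> size b = size c ->
  b =i c -> (forall j, j.+1 < size b -> repeated b j = repeated c j) -> b = c.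
Proof.
elim: b c => [|x b IH] [|x' c] //= sb sc [sz] bc rep.
have minx y z (d : seq nat) : path leq y d -> z \in y :: d -> y <= z.
  by rewrite inE => pd /orP[/eqP->//|/(allP (order_path_min leq_trans pd))].
have ex : x = x'.
  apply/eqP; rewrite eqn_leq (minx _ _ _ sb) ?bc ?mem_head //.
  by rewrite (minx _ _ _ sc) // -bc mem_head.
rewrite -{}ex in sc bc rep *; congr cons.
apply: (IH _ (path_sorted sb) (path_sorted sc) sz _ (fun j hj => rep j.+1 hj)).
case: b c {IH} sb sc sz bc rep => [|y b] [|y' c] //= sb sc sz bc rep z.
have /= := rep 0 isT; rewrite {1 2}/repeated /= => e.
have := bc z; rewrite ![z \in x :: _]inE; case: (z =P x) => //= -> _.
by rewrite (sorted_head_mem sb) (sorted_head_mem sc) e.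
Qed.

Section Code.

Variables (m k : nat).
Implicit Types (t : k.+1.-tuple 'I_m.+1) (S : {set 'I_m.+1}).

(** The k.+1 entries have k adjacent pairs, hence the k extra points. *)
Definition code t : {set 'I_(m.+1 + k)} :=
  [set z | match split z with inl x => x \in t | inr j => repeated (map val t) j end].

Lemma code_lshift t x : (lshift k x \in code t) = (x \in t).
Proof. by rewrite inE -[lshift k x]/(unsplit (inl x)) unsplitK. Qed.

Lemma code_rshift t (j : 'I_k) : (rshift m.+1 j \in code t) = repeated (map val t) j.
Proof. by rewrite inE -[rshift _ j]/(unsplit (inr j)) unsplitK. Qed.

Definition sorted_tuples := [set t : k.+1.-tuple 'I_m.+1 | sorted leq (map val t)].

Lemma card_code t : t \in sorted_tuples -> #|code t| = k.+1.
Proof.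
rewrite inE => st; have := size_undup_repeat st; rewrite size_map size_tuple /= => <-.
rewrite -sum1_card big_mkcond big_split_ord /=; congr (_ + _).
  under eq_bigr => x _ do rewrite code_lshift.
  rewrite -big_mkcond sum1_card /= undup_map_inj; last exact: val_inj.
  rewrite size_map -(card_uniqP (undup_uniq t)); apply: eq_card => x; by rewrite mem_undup.
by apply: eq_bigr => j _; rewrite code_rshift; case: repeated.
Qed.

Lemma code_inj : {in sorted_tuples &, injective code}.
Proof.
move=> t u; rewrite !inE => st su e; apply: val_inj; apply: (inj_map val_inj).
apply: eq_sorted_repeat; rewrite ?size_map ?size_tuple //.
  move=> x; apply/mapP/mapP => -[y yt ->]; exists y => //.
    by rewrite -code_lshift -e code_lshift.
  by rewrite -code_lshift e code_lshift.
move=> j; rewrite ltnS => jk.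
by rewrite -(code_rshift t (Ordinal jk)) e code_rshift.
Qed.

(** Surjectivity comes from counting: [code] is injective and [card_sorted_tuples] matches the
    number of k.+1-subsets. *)
Lemma code_image : code @: sorted_tuples = [set A : {set 'I_(m.+1 + k)} | #|A| == k.+1].
Proof.
apply/eqP; rewrite eqEcard (card_in_imset code_inj) card_draws card_ord card_sorted_tuples.
have -> : k.+1 + m = m.+1 + k by rewrite addSnnS addnC.
rewrite leqnn andbT.
by apply/subsetP=> _ /imsetP[t tT ->]; rewrite inE card_code.
Qed.

Lemma code_meets t S : ~~ [disjoint code t & lshift k @: S] = [exists x in S, x \in t].
Proof.
apply/idP/exists_inP => [|[x xS xt]].
  rewrite -setI_eq0 => /set0Pn[z /setIP[zt /imsetP[x xS e]]].
  by exists x; rewrite // -code_lshift -e.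
by apply/negP=> /disjointFl/(_ (imset_f _ xS)); rewrite code_lshift xt.
Qed.

End Code.

Arguments code {m k} t.

Lemma mdisjointP (m : nat) (A B : {mset 'I_m}) :
  reflect (forall x, x \in A -> x \notin B) (mdisjoint A B).
Proof.
apply: (iffP eqP) => [e x xA|dAB].
  by apply/negP=> xB; have := in_mset0 x; rewrite -e in_msetI xA xB.
case: (mset_0Vmem (msetI A B)) => // -[x]; rewrite in_msetI => /andP[/dAB/negP xB /xB].
by [].
Qed.

Lemma mem_seq_mset (m : nat) (t : seq 'I_m) x : (x \in seq_mset t) = (x \in t).
Proof. exact: perm_mem (perm_eq_seq_mset t) x. Qed.

(** * Transfer of the bound and of the equality case to multisets *)

Section Main.

Variables (m k s : nat) (F : {fset {mset 'I_m.+1}}).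
Hypotheses (hs : 0 < s) (hF : forall A : {mset 'I_m.+1}, A \in F -> size A = k.+1).
Hypothesis hdisj : at_most_pairwise_disjoint s F.
Hypothesis hms : (2 * s + 1) * k + s < m.+1 + k.

Local Notation tup := (k.+1.-tuple 'I_m.+1).

(** Multisets form an infinite type; sorted tuples represent those of size k.+1 uniquely in a finite
    one. *)
Definition tuple_family := [set t : tup | (t \in sorted_tuples m k) && (seq_mset t \in F)].

Lemma sorted_representative (A : {mset 'I_m.+1}) : size A = k.+1 ->
  exists2 t : tup, t \in sorted_tuples m k & seq_mset t = A.
Proof.
move=> sA; pose b := sort (fun x y : 'I_m.+1 => x <= y) A.
have sb : size b == k.+1 by rewrite size_sort sA.
exists (Tuple sb).
  by rewrite inE /= sorted_map; apply: sort_sorted => x y; apply: leq_total.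
by rewrite -[RHS]seq_mset_id; apply/eq_seq_msetP; rewrite perm_sort.
Qed.

Lemma seq_mset_inj : {in sorted_tuples m k &, injective (fun t : tup => seq_mset t)}.
Proof.
move=> t u; rewrite !inE => st su /eq_seq_msetP/(perm_map val) p.
apply: val_inj; apply: (inj_map val_inj).
exact: (sorted_eq leq_trans anti_leq).
Qed.

Lemma card_tuple_family : #|` F| = #|tuple_family|.
Proof.
have inj : {in enum tuple_family &, injective (fun t : tup => seq_mset t)}.
  by move=> t u; rewrite !mem_enum => /[!inE] /andP[tT _] /andP[uT _]; apply: seq_mset_inj; rewrite inE.
rewrite cardE -(size_map (fun t : tup => seq_mset t)); apply: perm_size; apply: uniq_perm.
- exact: fset_uniq.
- by rewrite map_inj_in_uniq ?enum_uniq.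
move=> A; apply/idP/mapP => [AF|[t]]; last by rewrite mem_enum inE => /andP[_ tF] ->.
have [t tT et] := sorted_representative (hF AF).
by exists t; rewrite // mem_enum inE tT et.
Qed.

(** Membership depends only on the size and on the trace on [m]; this is what forces the centre of a
    star into [m]. *)
Definition supersets := [set A : {set 'I_(m.+1 + k)} |
  (#|A| == k.+1) && [exists t in tuple_family, [forall x in t, lshift k x \in A]]].

Lemma no_disjoint_family_supersets : no_disjoint_family s supersets.
Proof.
move=> Q f cQ fA fD.
have ex x : x \in Q -> exists t : tup, (t \in tuple_family) && [forall y in t, lshift k y \in f x].
  by move=> /fA; rewrite inE => /andP[_ /exists_inP[t tF tf]]; exists t; rewrite tF.
(* By [ex], the default tuple is never taken for x in Q. *)
pose g x : tup := odflt [tuple of nseq k.+1 ord0]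
  [pick t : tup | (t \in tuple_family) && [forall y in t, lshift k y \in f x]].
have gP x : x \in Q -> seq_mset (g x) \in F /\ (forall y, y \in g x -> lshift k y \in f x).
  move=> /ex[t0 ht0]; rewrite /g; case: pickP => [t|/(_ t0)]; last by rewrite ht0.
  by rewrite inE => /andP[/andP[_ tF] /forall_inP tf].
have gD x y z : x \in Q -> y \in Q -> z \in g x -> z \in g y -> x = y.
  move=> xQ yQ /(proj2 (gP x xQ)) zx /(proj2 (gP y yQ)) zy; apply/eqP/negPn/negP=> xy.
  by rewrite (disjointFr (fD x y xQ yQ xy) zx) in zy.
pose G := [fset seq_mset (g x) | x in Q]%fset.
have : #|` G| <= s.
  apply: hdisj.
    by apply/fsubsetP=> _ /imfsetP[x /= xQ ->]; have [] := gP x xQ.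
  move=> _ _ /imfsetP[x /= xQ ->] /imfsetP[y /= yQ ->] nxy; apply/mdisjointP=> z.
  rewrite !mem_seq_mset => zx; apply: contra nxy => zy.
  by rewrite (gD x y z).
(* The chosen multisets are nonempty and share no element, hence distinct, so there are s + 1 of
   them. *)
rewrite card_in_imfset /=; last first.
  move=> x y xQ yQ e; have := mem_tnth ord0 (g x) => zx.
  by apply: (gD x y _ xQ yQ zx); rewrite -mem_seq_mset -e mem_seq_mset.
by rewrite -cardE cQ ltnn.
Qed.

Lemma sub_sorted : {subset tuple_family <= sorted_tuples m k}.
Proof. by move=> t; rewrite inE => /andP[]. Qed.

Lemma code_tuple_family_sub : code @: tuple_family \subset supersets.
Proof.
apply/subsetP=> _ /imsetP[t tF ->]; rewrite inE card_code ?sub_sorted // eqxx /=.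
by apply/exists_inP; exists t => //; apply/forall_inP=> x; rewrite code_lshift.
Qed.

Lemma card_code_tuple_family : #|code @: tuple_family| = #|` F|.
Proof.
rewrite card_tuple_family; apply: card_in_imset => t u /sub_sorted tT /sub_sorted uT.
exact: code_inj.
Qed.

(** If S had a point z beyond [m], take a k.+1-set B in [m] missing S and replace one point by z.
    The result lies in the star, so it contains the support of a member; that support avoids z,
    hence lies in B, and B would be in the star too. *)
Lemma star_supersets_original (S : {set 'I_(m.+1 + k)}) : #|S| = s ->
  supersets = star k.+1 S -> S \subset lshift k @: setT.
Proof.
move=> cS eS; apply/subsetP=> z zS; have [x ez|j ez] := split_ordP z.
  by rewrite ez imset_f.
set M := lshift k @: [set: 'I_m.+1].
have cM : #|M| = m.+1 by rewrite card_imset ?cardsT ?card_ord //; exact: lshift_inj.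
have [|B sB cB] := @subset_of_card _ (M :\: S) k.+1.
  have := subset_leq_card (subsetIr M S); rewrite cardsD cM cS; nia.
have /card_gt0P[y yB] : 0 < #|B| by rewrite cB.
have zM : z \notin M.
  by apply/imsetP=> -[x _]; rewrite ez => /eqP; rewrite eq_rlshift.
have zB : z \notin B by apply: contra zM => /(subsetP sB); rewrite inE => /andP[].
have : z |: (B :\ y) \in supersets.
  rewrite eS inE cardsU1 in_setD1 (negPf zB) andbF.
  have -> : #|B :\ y| = k by have := cardsD1 y B; rewrite yB cB => -[].
  rewrite eqxx /=.
  by apply/negP=> /disjointFr/(_ (setU11 _ _)); rewrite zS.
rewrite inE => /andP[_ /exists_inP[t tF /forall_inP tB]].
have : B \in supersets.
  rewrite inE cB eqxx; apply/exists_inP; exists t => //; apply/forall_inP=> x xt.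
  by have := tB x xt; rewrite !inE ez eq_lrshift => /andP[].
rewrite eS inE cB eqxx /= -setI_eq0 => /set0Pn[v /setIP[/(subsetP sB)]].
by rewrite inE => /andP[/negP].
Qed.

Lemma meeting_iff_star (S : {set 'I_m.+1}) :
  (forall A : {mset 'I_m.+1}, A \in F <-> kmultiset k.+1 A /\ intersecting A (mset_of_set S)) <->
  code @: tuple_family = star k.+1 (lshift k @: S).
Proof.
have meet (t : tup) : intersecting (seq_mset t) (mset_of_set S) = ~~ [disjoint code t & lshift k @: S].
  rewrite code_meets -[RHS]negbK; congr negb; apply/mdisjointP/exists_inPn => dS x.
    by move=> xS; apply/negP=> xt; have := dS x; rewrite !mem_seq_mset mem_enum xt xS => /(_ isT).
  by rewrite !mem_seq_mset mem_enum => xt; apply/negP=> /dS; rewrite xt.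
split=> [eF|e A].
  apply/setP=> A; apply/imsetP/idP => [[t]|].
    rewrite inE => /andP[tT /eF[_]]; rewrite meet => tS ->.
    by rewrite inE card_code ?eqxx.
  rewrite inE => /andP[cA mA]; have : A \in code @: sorted_tuples m k by rewrite code_image inE.
  case/imsetP=> t tT At; exists t; rewrite // inE tT; apply/eF; rewrite meet -At; split=> //.
  by rewrite /kmultiset (perm_size (perm_eq_seq_mset t)) size_tuple.
split=> [AF|[kA]].
  have [t tT tA] := sorted_representative (hF AF); split; first exact: hF.
  have : code t \in code @: tuple_family by rewrite imset_f // inE tT tA.
  by rewrite e inE -meet tA => /andP[].
have [t tT <-] := sorted_representative kA; rewrite meet => mt.
have : code t \in code @: tuple_family by rewrite e inE card_code ?eqxx.
case/imsetP=> u uF /code_inj tu; move: (uF); rewrite -tu // ?(sub_sorted uF) //.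
by rewrite inE => /andP[].
Qed.

(** In the equality case the codes of F fill [supersets], which is a star with centre in [m];
    [meeting_iff_star] reads this back for multisets. *)
Lemma multiset_matching :
  #|` F| <= 'C(m.+1 + k, k.+1) - 'C(m.+1 + k - s, k.+1) /\
  (#|` F| = 'C(m.+1 + k, k.+1) - 'C(m.+1 + k - s, k.+1) <->
   exists S : {set 'I_m.+1}, #|S| = s /\
     forall A : {mset 'I_m.+1},
       A \in F <-> kmultiset k.+1 A /\ intersecting A (mset_of_set S)).
Proof.
have uS A : A \in supersets -> #|A| = k.+1 by rewrite inE => /andP[/eqP].
have [le eq] := frankl_matching_bound hs hms uS no_disjoint_family_supersets.
have leF : #|` F| <= #|supersets|.
  by rewrite -card_code_tuple_family; apply: subset_leq_card code_tuple_family_sub.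
split; first exact: leq_trans leF le.
have cI (S : {set 'I_m.+1}) : #|lshift k @: S| = #|S| by rewrite card_imset //; exact: lshift_inj.
split=> [eF|[S [cS /meeting_iff_star e]]]; last first.
  by rewrite -card_code_tuple_family e card_star cI cS card_ord.
have eA : #|supersets| = 'C(m.+1 + k, k.+1) - 'C(m.+1 + k - s, k.+1).
  by apply/eqP; rewrite eqn_leq le -eF leF.
have [S cS eS] := eq eA.
have sS := star_supersets_original cS eS.
have e : S = lshift k @: (lshift k @^-1: S).
  apply/setP=> z; apply/idP/imsetP => [zS|[x]]; last by rewrite inE => xS ->.
  by have /imsetP[x _ zx] := subsetP sS z zS; exists x; rewrite // inE -zx.
exists (lshift k @^-1: S); split; first by rewrite -cI -e.
apply/meeting_iff_star; rewrite -e -eS; apply/eqP.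
by rewrite eqEcard code_tuple_family_sub card_code_tuple_family eF eA leqnn.
Qed.

End Main.

Theorem theorem3p4 (k m s : nat) (F : {fset {mset 'I_m}})
    (hk : 0 < k) (hm : 0 < m) (hs : 0 < s)
    (hF : forall A : {mset 'I_m}, A \in F -> kmultiset k A)
    (hdisj : at_most_pairwise_disjoint s F)
    (hms : (2 * k - 1) * s < m) :
  #|` F| <= 'C(m + k - 1, k) - 'C(m - s + k - 1, k) /\
  (#|` F| = 'C(m + k - 1, k) - 'C(m - s + k - 1, k) <->
   exists S : {set 'I_m}, #|S| = s /\
     forall A : {mset 'I_m},
       A \in F <-> kmultiset k A /\ intersecting A (mset_of_set S)).
Proof.
case: k hk hF hms => [|k] // _ hF hms.
case: m hm F hF hdisj hms => [|m] // _ F hF hdisj hms.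
have -> : m.+1 + k.+1 - 1 = m.+1 + k by lia.
have -> : m.+1 - s + k.+1 - 1 = m.+1 + k - s by nia.
(* After the change to successors, (2k + 1) s < m + 1 is the same condition as (2s + 1) k + s < m +
   1 + k. *)
by apply: multiset_matching => //; nia.
Qed.
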